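(* Let $H$ be a Hermitian operator on $\mathcal{H}=(\mathbb{C}^2)^{\otimes n}$ with spectral norm $\|H\|$, let $\lambda$ be such that $\langle \mathbb{1}\rangle(\lambda)>0$, let $M$ be the sample size of the estimators $\hat{\langle H\rangle}(\lambda)$ and $\hat{\langle \mathbb{1}\rangle}(\lambda)$, and let $\kappa>0$. Put $$\eta_H=\sqrt{\frac{\|H\|^2+\sigma_H^2}{\kappa M}},\qquad \eta_{\mathbb{1}}=\sqrt{\frac{1+\sigma_{\mathbb{1}}^2}{\kappa M}},\qquad \hat L''(\lambda)=\frac{\hat{\langle H\rangle}(\lambda)+\eta_H}{\hat{\langle \mathbb{1}\rangle}(\lambda)+\eta_{\mathbb{1}}}.$$ Then with probability at least $1-2\kappa$, $$\min\{\widetilde{\langle H\rangle}(\lambda),0\}\le \hat L''(\lambda)\le \widetilde{\langle H\rangle}(\lambda)+2\,\frac{\eta_H+\|H\|\eta_{\mathbb{1}}}{\langle \mathbb{1}\rangle(\lambda)}.$$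
   Context: Setting (variational quantum-circuit Monte Carlo). Fix $n$ qubits with Hilbert space $\mathcal{H}=(\mathbb{C}^2)^{\otimes n}$. A parameterised circuit gives normalised states $|\phi(\theta)\rangle=U(\theta)|0\rangle^{\otimes n}$, $\theta\in\Theta\subseteq\mathbb{R}^K$, with $U(\theta)$ unitary. A complex-valued guiding function $\alpha(\theta;\lambda)$ depends on parameters $\lambda$; let $C(\lambda)=\int_\Theta|\alpha(\theta;\lambda)|\,d\theta$ (finite and positive), $P(\theta;\lambda)=|\alpha(\theta;\lambda)|/C(\lambda)$, and $e^{i\gamma(\theta;\lambda)}=\alpha(\theta;\lambda)/|\alpha(\theta;\lambda)|$. The variational state is $|\psi(\lambda)\rangle=\int_\Theta P(\theta;\lambda)e^{i\gamma(\theta;\lambda)}|\phi(\theta)\rangle\,d\theta$. For an operator $O$, $\langle O\rangle(\lambda)=\langle\psi(\lambda)|O|\psi(\lambda)\rangle$ and $\widetilde{\langle O\rangle}(\lambda)=\langle O\rangle(\lambda)/\langle \mathbb{1}\rangle(\lambda)$. Estimator: for $\theta,\theta'$ let $X_{\theta,\theta'}=e^{i[\gamma(\theta;\lambda)-\gamma(\theta';\lambda)]}\langle\phi(\theta')|O|\phi(\theta)\rangle$. For each pair a measurement procedure outputs a random variable $\hat X_{\theta,\theta'}$; for Hermitian $O$ (here $O=H$ or $O=\mathbb{1}$) it is real-valued and unbiased for $\mathrm{Re}\,X_{\theta,\theta'}$ (whose average over the symmetric product density equals $\langle O\rangle(\lambda)$), with variance at most $\sigma_O^2$ for all $\theta,\theta'$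 ($\sigma_H^2$ for $O=H$, $\sigma_{\mathbb{1}}^2$ for $O=\mathbb{1}$). The estimator $\hat{\langle O\rangle}$ with sample size $M$ draws $M$ independent pairs $(\theta_l,\theta'_l)$ from the density $P(\theta;\lambda)P(\theta';\lambda)$, obtains independent $\hat X_{\theta_l,\theta'_l}$, and outputs their average. *)

(* Defs.v *)
From HB Require Import structures.
From mathcomp Require Import all_boot all_order all_algebra.
From mathcomp Require Import all_classical all_reals all_analysis.
From mathcomp Require Import complex.
Set Implicit Arguments. Unset Strict Implicit. Unset Printing Implicit Defensive.
Import Order.TTheory GRing.Theory Num.Theory.
Local Open Scope classical_set_scope.
Local Open Scope ring_scope.

Section QuantumMC.
Variable R : realType.
Local Notation C := (R[i]).

Definition cabs (z : C) : R := Num.sqrt (complex.Re z ^+ 2 + complex.Im z ^+ 2).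

Definition adj m n (A : 'M[C]_(m, n)) : 'M[C]_(n, m) := (map_mx (@conjc R) A)^T.

Definition qhermitian N (A : 'M[C]_N) : Prop := adj A = A.
Definition qunitary N (A : 'M[C]_N) : Prop := adj A *m A = 1%:M.

Definition vnorm N (v : 'cV[C]_N) : R := Num.sqrt (\sum_i (cabs (v i 0)) ^+ 2).

Definition opnorm N (A : 'M[C]_N) : R :=
  sup [set vnorm (A *m v) | v in [set v : 'cV[C]_N | vnorm v = 1]].

(* |0>^{\otimes n} in the computational basis of (C^2)^{\otimes n} = C^(2^n) *)
Definition ket0 n : 'cV[C]_(2 ^ n) := \col_i (if val i == 0%N then 1 else 0).

Definition Cintegral d (T : measurableType d) (mu : {measure set T -> \bar R})
  (f : T -> C) : C :=
  Complex (Rintegral mu setT (fun x => complex.Re (f x))) (Rintegral mu setT (fun x => complex.Im (f x))).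

Section Setting.
Context d (Theta : measurableType d) (mu : {measure set Theta -> \bar R}).
Context (n : nat) (U : Theta -> 'M[C]_(2 ^ n)) (alpha : Theta -> C).

Definition phi (t : Theta) : 'cV[C]_(2 ^ n) := U t *m ket0 n.

Definition normconst : R := Rintegral mu setT (fun t => cabs (alpha t)).

Definition Pdens (t : Theta) : R := cabs (alpha t) / normconst.

Definition phase (t : Theta) : C := alpha t / (cabs (alpha t))%:C%C.

Definition psi : 'cV[C]_(2 ^ n) :=
  \col_j Cintegral mu (fun t => (Pdens t)%:C%C * phase t * phi t j 0).

Definition expect (O : 'M[C]_(2 ^ n)) : C := (adj psi *m O *m psi) 0 0.

Definition Xpair (O : 'M[C]_(2 ^ n)) (t t' : Theta) : C :=
  phase t * conjc (phase t') * (adj (phi t') *m O *m phi t) 0 0.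
End Setting.

Definition mutual_indep dO dT (Omega : measurableType dO) (T : measurableType dT)
  (Pr : probability Omega R) (I : finType) (Z : I -> Omega -> T) : Prop :=
  forall (S : {set I}) (E : I -> set T), (forall i, measurable (E i)) ->
    Pr (\bigcap_(i in [set i | i \in S]) (Z i @^-1` E i))
    = \big[*%E/1%E]_(i in S) Pr (Z i @^-1` E i).

(* The sampling/measurement model of an estimator with sample size M:
   M independent triples (theta_l, theta'_l, Xhat_l); (theta_l, theta'_l) has
   density P(theta)P(theta') and, given (theta_l,theta'_l) = (t,t'), Xhat_l is
   distributed according to k(t,t'), a law with mean Re X_{t,t'} and variance
   at most sigma^2. *)
Definition estimator_model dO (Omega : measurableType dO) (Pr : probability Omega R)
  d (Theta : measurableType d) (mu : {measure set Theta -> \bar R})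
  (P : Theta -> R) (Xre : Theta -> Theta -> R) (sigma : R) (M : nat)
  (a b : 'I_M -> Omega -> Theta) (Y : 'I_M -> Omega -> R) : Prop :=
  [/\ forall l, [/\ measurable_fun setT (a l), measurable_fun setT (b l)
                  & measurable_fun setT (Y l)],
      mutual_indep Pr (fun l w => (a l w, b l w, Y l w)) &
      exists k : R.-pker (Theta * Theta)%type ~> R,
        (forall t t', [/\ (k (t, t')).-integrable setT EFin,
            (\int[k (t, t')]_y (y%:E) = (Xre t t')%:E)%E &
            (\int[k (t, t')]_y (((y - Xre t t') ^+ 2)%:E) <= (sigma ^+ 2)%:E)%E]) /\
        (forall l (A B : set Theta) (F : set R),
            measurable A -> measurable B -> measurable F ->
            Pr [set w | A (a l w) /\ B (b l w) /\ F (Y l w)]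
            = (\int[mu]_(t in A) \int[mu]_(t' in B)
                 ((P t * P t')%:E * k (t, t') F))%E)].

Definition estimate dO (Omega : measurableType dO) (M : nat) (Y : 'I_M -> Omega -> R)
  (w : Omega) : R := (\sum_(l < M) Y l w) / M%:R.

End QuantumMC.

(* Main.v *)
(* The law of a single measured value is the mixture of the kernel laws over
   Q x Q, where Q is the probability with density P. Its mean is the iterated
   integral of Re X, that is Re <psi|O|psi>, and its second moment is at most
   h^2 + sigma^2 as soon as |O v| <= h |v|. Independent copies are uncorrelated,
   so Chebyshev's inequality puts each estimator within eta of its mean up to
   probability kappa (h = ||H|| for H, h = 1 for the identity). When both
   estimators are that close, the shifted numerator lies in [<H>, <H> + 2 eta_H]
   and the shifted denominator in [<1>, <1> + 2 eta_1], and the bounds on the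
   ratio follow from |<H>| <= ||H|| <1>. *)
Require Import Defs.
From HB Require Import structures.
From mathcomp Require Import all_boot all_order all_algebra.
From mathcomp Require Import all_classical all_reals all_analysis.
From mathcomp Require Import complex.
From mathcomp Require Import measurable_realfun.
From mathcomp Require Import ring lra.
Set Implicit Arguments. Unset Strict Implicit. Unset Printing Implicit Defensive.
Import Order.TTheory GRing.Theory Num.Theory.
Local Open Scope classical_set_scope.
Local Open Scope ring_scope.

(** * Euclidean and operator norms *)

Section LinearAlgebra.
Variable R : realType.
Local Notation C := (R[i]).

Lemma Re_sum (I : Type) (r : seq I) (P : pred I) (F : I -> C) :
  complex.Re (\sum_(i <- r | P i) F i) = \sum_(i <- r | P i) complex.Re (F i).
Proof. by apply: (big_morph (@complex.Re R)) => // -[a b] [c e]. Qed.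

Lemma Im_sum (I : Type) (r : seq I) (P : pred I) (F : I -> C) :
  complex.Im (\sum_(i <- r | P i) F i) = \sum_(i <- r | P i) complex.Im (F i).
Proof. by apply: (big_morph (@complex.Im R)) => // -[a b] [c e]. Qed.

Lemma ReM (x y : C) : complex.Re (x * y) =
  complex.Re x * complex.Re y - complex.Im x * complex.Im y.
Proof. by case: x y => [a b] [c e]. Qed.

Lemma ImM (x y : C) : complex.Im (x * y) =
  complex.Re x * complex.Im y + complex.Im x * complex.Re y.
Proof. by case: x y => [a b] [c e]. Qed.

Lemma Re_conjc (x : C) : complex.Re (conjc x) = complex.Re x.
Proof. by case: x. Qed.

Lemma Im_conjc (x : C) : complex.Im (conjc x) = - complex.Im x.
Proof. by case: x. Qed.

Lemma cabs_normc (z : C) : cabs z = Normc.normc z.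
Proof. by case: z. Qed.

Lemma cabs_ge0 (z : C) : 0 <= cabs z.
Proof. exact: sqrtr_ge0. Qed.

Lemma sqr_cabs (z : C) : cabs z ^+ 2 = complex.Re z ^+ 2 + complex.Im z ^+ 2.
Proof. by rewrite sqr_sqrtr// addr_ge0// sqr_ge0. Qed.

Lemma cabsM (x y : C) : cabs (x * y) = cabs x * cabs y.
Proof. by rewrite !cabs_normc Normc.normcM. Qed.

Lemma cabsN (x : C) : cabs (- x) = cabs x.
Proof. by case: x => a b; rewrite /cabs/= !sqrrN. Qed.

Lemma Re_le_cabs (x : C) : `|complex.Re x| <= cabs x.
Proof.
by rewrite -sqrtr_sqr ler_wsqrtr// lerDl sqr_ge0.
Qed.

Lemma Im_le_cabs (x : C) : `|complex.Im x| <= cabs x.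
Proof.
by rewrite -sqrtr_sqr ler_wsqrtr// lerDr sqr_ge0.
Qed.

Lemma cabs_sum (I : Type) (r : seq I) (F : I -> C) :
  cabs (\sum_(i <- r) F i) <= \sum_(i <- r) cabs (F i).
Proof.
elim/big_ind2: _ => [|x a y b xa yb|//].
  by rewrite cabs_normc Normc.normc0.
by rewrite cabs_normc (le_trans (le_normcD _ _))// -!cabs_normc lerD.
Qed.

Lemma vnorm_ge0 N (v : 'cV[C]_N) : 0 <= vnorm v.
Proof. exact: sqrtr_ge0. Qed.

Lemma sqr_vnorm N (v : 'cV[C]_N) : vnorm v ^+ 2 = \sum_i cabs (v i 0) ^+ 2.
Proof. by rewrite sqr_sqrtr// sumr_ge0// => i _; rewrite sqr_ge0. Qed.

Lemma Re_inner N (u w : 'cV[C]_N) : complex.Re ((adj u *m w) 0 0) =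
  \sum_i (complex.Re (u i 0) * complex.Re (w i 0) +
          complex.Im (u i 0) * complex.Im (w i 0)).
Proof.
rewrite mxE Re_sum; apply: eq_bigr => i _.
by rewrite !mxE ReM Re_conjc Im_conjc mulNr opprK.
Qed.

Lemma sqr_vnorm_inner N (v : 'cV[C]_N) :
  vnorm v ^+ 2 = complex.Re ((adj v *m v) 0 0).
Proof.
by rewrite sqr_vnorm Re_inner; apply: eq_bigr => i _; rewrite sqr_cabs !expr2.
Qed.

Lemma vnormZ N (a : C) (v : 'cV[C]_N) : vnorm (a *: v) = cabs a * vnorm v.
Proof.
apply: (@pexpIrn _ 2) => //; rewrite ?nnegrE ?mulr_ge0 ?vnorm_ge0 ?cabs_ge0//.
rewrite exprMn !sqr_vnorm mulr_sumr; apply: eq_bigr => i _.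
by rewrite !mxE cabsM exprMn.
Qed.

Lemma vnorm_eq0 N (v : 'cV[C]_N) : vnorm v = 0 -> v = 0.
Proof.
move=> v0; apply/matrixP => i j; rewrite ord1 mxE.
have : \sum_i cabs (v i 0) ^+ 2 = 0 by rewrite -sqr_vnorm v0 expr0n.
move/eqP; rewrite psumr_eq0; last by move=> k _; rewrite sqr_ge0.
move=> /allP/(_ i (mem_index_enum _)) /=; rewrite sqrf_eq0 cabs_normc => /eqP.
exact: Normc.eq0_normc.
Qed.

(** Cauchy-Schwarz. With [s] and [t] the norms of [u] and [w], the squared norm of [t u - s w]
    equals [2 s t (s t - Re <u, w>)] and is nonnegative. Cancelling [s t] requires both norms
    nonzero, so null vectors come first. *)
Lemma Re_inner_le N (u w : 'cV[C]_N) :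
  complex.Re ((adj u *m w) 0 0) <= vnorm u * vnorm w.
Proof.
have [/vnorm_eq0 ->|u0] := eqVneq (vnorm u) 0.
  rewrite Re_inner big1 ?mulr_ge0 ?vnorm_ge0// => i _.
  by rewrite mxE/= !mul0r addr0.
have [/vnorm_eq0 ->|w0] := eqVneq (vnorm w) 0.
  rewrite Re_inner big1 ?mulr_ge0 ?vnorm_ge0// => i _.
  by rewrite mxE/= !mulr0 addr0.
set s := vnorm u; set t := vnorm w.
have st0 : 0 < s * t by rewrite mulr_gt0// lt0r ?u0 ?w0 vnorm_ge0.
have : 0 <= \sum_i ((t * complex.Re (u i 0) - s * complex.Re (w i 0)) ^+ 2 +
                    (t * complex.Im (u i 0) - s * complex.Im (w i 0)) ^+ 2).
  by rewrite sumr_ge0// => i _; rewrite addr_ge0// sqr_ge0.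
have -> : \sum_i ((t * complex.Re (u i 0) - s * complex.Re (w i 0)) ^+ 2 +
                  (t * complex.Im (u i 0) - s * complex.Im (w i 0)) ^+ 2) =
    t ^+ 2 * s ^+ 2 + s ^+ 2 * t ^+ 2 -
    2 * (s * t) * complex.Re ((adj u *m w) 0 0).
  rewrite Re_inner [X in _ * X + _](sqr_vnorm u) [X in _ + _ * X - _]sqr_vnorm.
  rewrite !mulr_sumr -sumrN -!big_split/=; apply: eq_bigr => i _.
  by rewrite !sqr_cabs; ring.
by move=> h; rewrite -(ler_pM2l st0); lra.
Qed.

Lemma normr_Re_inner_le N (u w : 'cV[C]_N) :
  `|complex.Re ((adj u *m w) 0 0)| <= vnorm u * vnorm w.
Proof.
rewrite ler_norml Re_inner_le andbT lerNl.
have -> : - complex.Re ((adj u *m w) 0 0) = complex.Re ((adj (- u) *m w) 0 0).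
  rewrite !Re_inner -sumrN; apply: eq_bigr => i _.
  by rewrite !mxE; case: (u i 0) => a b /=; rewrite opprD !mulNr.
by rewrite (le_trans (Re_inner_le _ _))// -scaleN1r vnormZ cabsN cabs_normc
  Normc.normc1 mul1r.
Qed.

Lemma cabs_le_vnorm N (v : 'cV[C]_N) i : cabs (v i 0) <= vnorm v.
Proof.
rewrite -(@ler_pXn2r _ 2) ?nnegrE ?cabs_ge0 ?vnorm_ge0//.
by rewrite sqr_vnorm (bigD1 i)//= lerDl sumr_ge0// => j _; rewrite sqr_ge0.
Qed.

(** A [sup] is an upper bound only for a bounded set, so [opnorm] needs this first. Entries of a
    unit vector have modulus at most 1, hence each entry of [A *m v] is at most the absolute row sum
    of [A]; this gives the witness. *)
Lemma vnorm_mulmx_bounded N (A : 'M[C]_N) :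
  exists K, forall v : 'cV[C]_N, vnorm v = 1 -> vnorm (A *m v) <= K.
Proof.
exists (Num.sqrt (\sum_i (\sum_j cabs (A i j)) ^+ 2)) => v v1.
rewrite ler_wsqrtr// ler_sum// => i _.
rewrite ler_sqr ?nnegrE ?cabs_ge0 ?sumr_ge0//; last first.
  by move=> j _; exact: cabs_ge0.
rewrite mxE (le_trans (cabs_sum _ _))// ler_sum// => j _.
by rewrite cabsM ler_piMr ?cabs_ge0// -v1 cabs_le_vnorm.
Qed.

(** Rescaling [v] to norm one puts it in the set whose supremum is [opnorm A]; the zero vector is
    treated apart. *)
Lemma vnorm_mulmx_le N (A : 'M[C]_N) (v : 'cV[C]_N) :
  vnorm (A *m v) <= opnorm A * vnorm v.
Proof.
have [v0|v0] := eqVneq (vnorm v) 0.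
  by rewrite v0 mulr0 (vnorm_eq0 v0) mulmx0 -(scale0r 0) vnormZ cabs_normc
    Normc.normc0 mul0r.
pose a : C := ((vnorm v)^-1)%:C%C.
have va : 0 <= (vnorm v)^-1 by rewrite invr_ge0 vnorm_ge0.
have ca : cabs a = (vnorm v)^-1.
  by rewrite /cabs/= expr0n/= addr0 sqrtr_sqr ger0_norm.
have v1 : vnorm (a *: v) = 1 by rewrite vnormZ ca mulVf.
rewrite -ler_pdivrMr; last by rewrite lt0r v0 vnorm_ge0.
have [K AK] := vnorm_mulmx_bounded A.
apply: ub_le_sup; first by exists K => _ [w /AK wK <-].
by exists (a *: v) => //; rewrite -scalemxAr vnormZ ca mulrC.
Qed.

Lemma vnorm_unitary N (V : 'M[C]_N) (v : 'cV[C]_N) :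
  qunitary V -> vnorm (V *m v) = vnorm v.
Proof.
move=> VV; apply: (@pexpIrn _ 2) => //; rewrite ?nnegrE ?vnorm_ge0//.
rewrite !sqr_vnorm_inner /adj map_mxM trmx_mul -!mulmxA (mulmxA _ V).
by rewrite [X in X *m v](_ : _ = 1%:M) ?mul1mx.
Qed.

Lemma vnorm_ket0 n : vnorm (ket0 R n) = 1.
Proof.
have n0 : (0 < 2 ^ n)%N by rewrite expn_gt0.
rewrite /vnorm (bigD1 (Ordinal n0))//= big1 ?addr0 => [|i i0].
  by rewrite mxE/= cabs_normc Normc.normc1 expr1n sqrtr1.
have -> : ket0 R n i 0 = 0.
  by rewrite mxE; case: eqP => // i0'; move: i0; rewrite -val_eqE/= i0'.
by rewrite cabs_normc Normc.normc0 expr0n.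
Qed.

End LinearAlgebra.

(** * Mixtures of laws and their moments *)

Section Mixture.
Import HBNNSimple.
Local Open Scope ereal_scope.
Context d d' (Z : measurableType d) (Y : measurableType d') (R : realType).
Variables (m : {measure set Z -> \bar R}) (k : Z -> {measure set Y -> \bar R}).
Hypothesis mk : forall A, measurable A -> measurable_fun [set: Z] (k ^~ A).
Variable nu : {measure set Y -> \bar R}.
Hypothesis nuE : forall A, measurable A -> nu A = \int[m]_z k z A.

(** Both sides are finite sums of values times measures of level sets, and on each level set the
    claim is [nuE]. *)
Lemma nnsfun_integral_mixture (f : {nnsfun Y >-> R}) :
  \int[nu]_y (f y)%:E = \int[m]_z \int[k z]_y (f y)%:E.
Proof.
under [RHS]eq_integral do rewrite integralT_nnsfun sintegralET.
rewrite integralT_nnsfun sintegralE.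
(* The range of [f] is a finite index set common to all [z], so sum and integral can be
   exchanged. *)
have -> : \int[m]_z \sum_(x \in [set: R]) x%:E * k z (f @^-1` [set x]) =
    \int[m]_z \sum_(x \in range f) x%:E * k z (f @^-1` [set x]).
  by apply: eq_integral => z _; rewrite -sintegralET sintegralE.
have mf (x : R) : measurable (f @^-1` [set x]) by exact: measurable_sfunP.
rewrite ge0_integral_fsum//; last 2 first.
- by move=> x; apply: measurable_funeM; exact: mk (mf x).
- by move=> x z _; exact: nnsfun_mulemu_ge0.
apply: eq_fsbigr => x /set_mem[y _ <-].
have mkf : measurable_fun [set: Z] (fun z => k z (f @^-1` [set f y])).
  exact: mk (mf _).
by rewrite ge0_integralZl ?lee_fin// nuE.
Qed.

(** Simple functions increase to [f]; monotone convergence is used under [nu], under each [k z] and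
    under [m]. *)
Lemma ge0_integral_mixture (f : Y -> \bar R) : (forall y, 0 <= f y) ->
  measurable_fun setT f -> \int[nu]_y f y = \int[m]_z \int[k z]_y f y.
Proof.
move=> f0 mf; pose f_ := nnsfun_approx measurableT mf.
have mf_ n : measurable_fun setT (fun y => (f_ n y)%:E).
  exact/measurable_EFinP.
have f_ge0 n y : [set: Y] y -> 0 <= (f_ n y)%:E by rewrite lee_fin.
have f_nd y : [set: Y] y -> nondecreasing_seq (fun n => (f_ n y)%:E).
  by move=> _ a b ab; rewrite lee_fin; exact/lefP/nd_nnsfun_approx.
have f_lim y : f y = limn (fun n => (f_ n y)%:E).
  by apply/esym/cvg_lim => //; exact: cvg_nnsfun_approx.
under eq_integral do rewrite f_lim.
rewrite monotone_convergence//.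
under eq_fun do rewrite nnsfun_integral_mixture.
rewrite -monotone_convergence//.
- apply: eq_integral => z _; rewrite -monotone_convergence//.
  by apply: eq_integral => y _; rewrite f_lim.
- by move=> n; apply: measurable_fun_integral_kernel => // y; exact: f_ge0.
- by move=> n z _; apply: integral_ge0 => y _; exact: f_ge0.
- move=> z _ a b ab; apply: ge0_le_integral => //; try exact: f_ge0.
  by move=> y _; exact: f_nd.
Qed.

End Mixture.

(** * Probability measures given by a density *)

Section Density.
Local Open Scope ereal_scope.
Context d (T : measurableType d) (R : realType) (mu : {measure set T -> \bar R}).
Variable p : T -> R.

(** The proofs are arguments so that the probability structure can be inferred from the term
    itself. *)
Definition density_prob (p0 : forall t, (0 <= p t)%R)
  (mp : measurable_fun setT p) (p1 : \int[mu]_t (p t)%:E = 1) (A : set T) :=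
  \int[mu]_(t in A) (p t)%:E.

Variables (p0 : forall t, (0 <= p t)%R) (mp : measurable_fun setT p).
Variable p1 : \int[mu]_t (p t)%:E = 1.
Local Notation Q := (density_prob p0 mp p1).

Let Q0 : Q set0 = 0.
Proof. by rewrite /density_prob integral_set0. Qed.

Let Q_ge0 A : 0 <= Q A.
Proof. by apply: integral_ge0 => t _; rewrite lee_fin. Qed.

Let Q_additive : semi_sigma_additive Q.
Proof.
move=> F mF tF mUF; rewrite /density_prob ge0_integral_bigcup//.
- apply: is_cvg_ereal_nneg_natsum_cond => n _ _; exact: Q_ge0.
- exact/measurable_EFinP/measurable_funTS.
- by move=> t _; rewrite lee_fin.
Qed.

HB.instance Definition _ := isMeasure.Build _ _ _ Q Q0 Q_ge0 Q_additive.

Let Q_setT : Q setT = 1.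
Proof. exact: p1. Qed.

HB.instance Definition _ := Measure_isProbability.Build _ _ _ Q Q_setT.

(** A density is a special mixture: the kernel at [t] is the Dirac mass at [t] scaled by [p t]. *)
Lemma ge0_integral_density (f : T -> \bar R) : (forall t, 0 <= f t) ->
  measurable_fun setT f -> \int[Q]_t f t = \int[mu]_t ((p t)%:E * f t).
Proof.
move=> f0 mf.
pose k t : {measure set T -> \bar R} := mscale (NngNum (p0 t)) (dirac t).
have kE t A : k t A = (p t)%:E * (\1_A t)%:E by [].
rewrite [LHS](@ge0_integral_mixture _ _ _ _ _ mu k)//.
- apply: eq_integral => t _; rewrite ge0_integral_mscale//.
  by rewrite integral_dirac// diracT mul1e.
- move=> A mA; under eq_fun do rewrite kE.
  by apply: emeasurable_funM; apply/measurable_EFinP.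
- move=> A mA; rewrite /= /density_prob integral_mkcond.
  apply: eq_integral => t _; rewrite kE patchE indicE.
  by case: (t \in A); rewrite ?mule1 ?mule0.
Qed.

(** Multiplication by [p t >= 0] commutes with positive and negative parts, so the nonnegative case
    applies to each. *)
Lemma Rintegral_density (f : T -> R) : measurable_fun setT f ->
  (\int[Q]_t f t = \int[mu]_t (p t * f t))%R.
Proof.
move=> mf; rewrite /Rintegral; congr fine; rewrite integralE [RHS]integralE.
have mfE : measurable_fun setT (EFin \o f) by exact/measurable_EFinP.
rewrite !ge0_integral_density//; last 2 first.
- exact: measurable_funeneg.
- exact: measurable_funepos.
congr (_ - _); apply: eq_integral => t _.
- by rewrite funeposE funeposE/= EFinM maxe_pMr ?lee_fin// mule0.
- by rewrite !funenegE/= -mulrN EFinM maxe_pMr ?lee_fin// mule0.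
Qed.

End Density.

(** * First and second moments of a mixture of laws *)

Section Moments.
Local Open Scope ereal_scope.
Context (R : realType).

Lemma integrable_cst_mass1 d (T : measurableType d)
    (P : {measure set T -> \bar R}) (r : R) :
  P setT = 1 -> P.-integrable setT (fun=> r%:E).
Proof.
move=> P1; apply/integrableP; split; first exact: measurable_cst.
by rewrite integral_cst// P1 mule1 ltry.
Qed.

Lemma integral_cst_mass1 d (T : measurableType d)
    (P : {measure set T -> \bar R}) (r : R) :
  P setT = 1 -> \int[P]_x r%:E = r%:E.
Proof. by move=> P1; rewrite integral_cst// P1 mule1. Qed.

(** Under total mass one, constants are integrable, and [|f| <= 1 + f ^+ 2]. *)
Lemma sqr_integrable d (T : measurableType d) (P : {measure set T -> \bar R})
    (f : T -> R) (v : R) : P setT = 1 -> measurable_fun setT f ->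
  \int[P]_t ((f t ^+ 2)%:E) <= v%:E ->
  P.-integrable setT (EFin \o f) /\
  P.-integrable setT (fun t => (f t ^+ 2)%:E).
Proof.
move=> P1 mf fv.
have f2 : P.-integrable setT (fun t => (f t ^+ 2)%:E).
  apply/integrableP; split.
    by apply/measurable_EFinP; exact: measurable_funX.
  under eq_integral => t _ do rewrite gee0_abs ?lee_fin ?sqr_ge0//.
  by rewrite (le_lt_trans fv)// ltry.
split=> //; apply: (@le_integrable _ _ _ P _ measurableT _
    (fun t => (1 + f t ^+ 2)%:E)) => //.
- exact/measurable_EFinP.
- move=> t _; rewrite /= lee_fin [leRHS]ger0_norm ?addr_ge0 ?sqr_ge0//.
  by rewrite ler_norml; apply/andP; split; nra.
- under eq_fun do rewrite EFinD.
  by apply: integrableD => //; exact: integrable_cst_mass1.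
Qed.

Context d (Z : measurableType d).
Variables (P : probability Z R) (k : R.-pker Z ~> R) (x : Z -> R) (s h : R).
Hypothesis k_int : forall z, (k z).-integrable setT EFin.
Hypothesis k_mean : forall z, \int[k z]_y y%:E = (x z)%:E.
Hypothesis k_var : forall z, \int[k z]_y ((y - x z) ^+ 2)%:E <= (s ^+ 2)%:E.
Hypothesis x_le : forall z, (`|x z| <= h)%R.

(** Variance plus squared mean: in the expansion of [y ^+ 2] around [x z], the last two terms
    integrate to [x z ^+ 2], at most [h ^+ 2]. *)
Lemma kernel_second_moment z :
  \int[k z]_y (y ^+ 2)%:E <= (h ^+ 2 + s ^+ 2)%:E.
Proof.
have k1 : k z setT = 1 by exact: prob_kernel.
have my : measurable_fun setT (fun y : R => y - x z)%R.
  by apply: measurable_funB.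
have [_ iV] := sqr_integrable k1 my (k_var z).
have iL : (k z).-integrable setT (fun y => (2 * x z)%:E * y%:E).
  exact: integrableZl.
have iC : (k z).-integrable setT (fun y => (- x z ^+ 2)%:E).
  exact: integrable_cst_mass1.
have -> : \int[k z]_y (y ^+ 2)%:E =
    \int[k z]_y (((y - x z) ^+ 2)%:E + ((2 * x z)%:E * y%:E + (- x z ^+ 2)%:E)).
  by apply: eq_integral => y _; rewrite -EFinM -!EFinD; congr EFin; ring.
rewrite integralD//; last exact: integrableD.
rewrite integralD// integralZl// k_mean integral_cst_mass1//.
rewrite -EFinM -EFinD addeC [leRHS]EFinD; apply: leeD => //.
rewrite lee_fin; have := x_le z; rewrite ler_norml => /andP[]; nra.
Qed.

Variable nu : probability R R.
Hypothesis nuE : forall A, measurable A -> nu A = \int[P]_z k z A.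

Lemma mixture_second_moment :
  \int[nu]_y (y ^+ 2)%:E <= (h ^+ 2 + s ^+ 2)%:E.
Proof.
rewrite (@ge0_integral_mixture _ _ _ _ _ P k)//; first last.
- by apply/measurable_EFinP; exact: measurable_funX.
- by move=> y; rewrite lee_fin sqr_ge0.
- by move=> A mA; exact: measurable_kernel.
apply: le_trans (_ : \int[P]_z (cst (h ^+ 2 + s ^+ 2)%:E z) <= _).
  apply: ge0_le_integral => //.
  - by move=> z _; apply: integral_ge0 => y _; rewrite lee_fin sqr_ge0.
  - apply: measurable_fun_integral_kernel.
    + by move=> A mA; exact: measurable_kernel.
    + by move=> y; rewrite lee_fin sqr_ge0.
    + by apply/measurable_EFinP; exact: measurable_funX.
  - by move=> z _; exact: kernel_second_moment.
by rewrite integral_cst_mass1//; exact: probability_setT.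
Qed.

(** The positive and negative parts of the identity are mixed separately. Their difference
    recombines because the finite second moment makes both integrable. *)
Lemma mixture_mean : \int[nu]_y y%:E = \int[P]_z (x z)%:E.
Proof.
have [nu_int _] := sqr_integrable (@probability_setT _ _ _ nu)
  (@measurable_id _ R setT) mixture_second_moment.
have mk A : measurable A -> measurable_fun [set: Z] (k ^~ A).
  by move=> mA; exact: measurable_kernel.
(* Integrability under [nu] passes to the inner integrals under [P], as needed to subtract the two
   parts. *)
have pos (f : R -> \bar R) : (forall y, 0 <= f y) -> measurable_fun setT f ->
    nu.-integrable setT f -> P.-integrable setT (fun z => \int[k z]_y f y).
  move=> f0 mf /integrableP[_ fi]; apply/integrableP; split.
    exact: measurable_fun_integral_kernel.
  under eq_integral => z _ do rewrite gee0_abs ?integral_ge0//.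
  rewrite -(ge0_integral_mixture mk nuE)//.
  by under eq_integral => y _ do rewrite -(gee0_abs (f0 _)).
have mpos : measurable_fun setT (EFin \o id : R -> \bar R)^\+.
  by apply: measurable_funepos; apply/measurable_EFinP.
have mneg : measurable_fun setT (EFin \o id : R -> \bar R)^\-.
  by apply: measurable_funeneg; apply/measurable_EFinP.
rewrite integralE !(ge0_integral_mixture mk nuE)// -integralB//; last 2 first.
- by apply: pos => //; exact: integrable_funepos.
- by apply: pos => //; exact: integrable_funeneg.
by apply: eq_integral => z _; rewrite -k_mean [RHS]integralE.
Qed.

End Moments.

(** * Concentration of empirical means *)

Section Concentration.
Local Open Scope ereal_scope.
Context d (Omega : measurableType d) (R : realType) (Pr : probability Omega R).

(** Markov's inequality for a strict excess, which remains true at [c = 0]. That case occurs when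
    the second-moment bound [v] vanishes, so that the allowed deviation is 0. *)
Lemma markov_strict (f : Omega -> R) (c kappa : R) :
  measurable_fun setT f -> (forall w, 0 <= f w)%R -> (0 <= c)%R ->
  (0 <= kappa)%R -> \int[Pr]_w (f w)%:E <= (kappa * c)%:E ->
  Pr [set w | (c < f w)%R] <= kappa%:E.
Proof.
move=> mf f0 c0 k0 fc.
have mfE : measurable_fun setT (EFin \o f) by exact/measurable_EFinP.
have absf : \int[Pr]_w `|(EFin \o f) w| <= (kappa * c)%:E.
  by under eq_integral => w _ do rewrite /= ger0_norm//.
have mlt : measurable [set w | (c < f w)%R].
  rewrite -[X in measurable X]setTI.
  exact: (emeasurable_fun_o_infty measurableT mfE c%:E).
move: c0; rewrite le_eqVlt => /predU1P[c0|c0]; last first.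
  have := le_integral_abse Pr measurableT mfE c0; rewrite setTI => le1.
  rewrite -(@lee_pmul2l _ c%:E) ?lte_fin//.
  rewrite [leRHS]muleC -EFinM; apply: le_trans (le_trans le1 absf).
  rewrite lee_pmul2l ?lte_fin// le_measure ?inE//.
    rewrite (_ : [set _ | _] = setT `&` [set w | c%:E <= `|(EFin \o f) w|]).
      by apply: emeasurable_fun_c_infty => //; exact: measurableT_comp.
    by rewrite setTI.
  by move=> w /= cf; rewrite lee_fin ger0_norm// ltW.
(* For [c = 0] the integral of [f] is 0, so [f] vanishes almost everywhere and the event is null. *)
rewrite -c0 mulr0 in absf.
have /(ae_eq_integral_abs _ measurableT mfE) [N [mN N0 fN]] :
    \int[Pr]_w `|(EFin \o f) w| = 0.
  by apply/eqP; rewrite eq_le absf integral_ge0.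
rewrite (@subset_measure0 _ _ _ _ _ N)// => w/= cw.
by apply: fN => /= /(_ I) [fw]; rewrite -c0 fw ltxx in cw.
Qed.

Variables (M : nat) (Y : 'I_M -> {RV Pr >-> R}) (e v kappa : R).
Hypothesis Y_indep : forall l m, l != m -> forall A B : set R,
  measurable A -> measurable B ->
  Pr (Y l @^-1` A `&` Y m @^-1` B) = Pr (Y l @^-1` A) * Pr (Y m @^-1` B).
Hypothesis Y_mean : forall l, \int[Pr]_w (Y l w)%:E = e%:E.
Hypothesis Y_sqr : forall l, \int[Pr]_w (Y l w ^+ 2)%:E <= v%:E.

Let Y_int l : Pr.-integrable setT (fun w => (Y l w)%:E).
Proof.
exact: (sqr_integrable (@probability_setT _ _ _ Pr) (measurable_funP (Y l))
  (Y_sqr l)).1.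
Qed.

Let Y2_int l : Pr.-integrable setT (fun w => (Y l w ^+ 2)%:E).
Proof.
exact: (sqr_integrable (@probability_setT _ _ _ Pr) (measurable_funP (Y l))
  (Y_sqr l)).2.
Qed.

Let Pr1 (r : R) : Pr.-integrable setT (fun=> r%:E).
Proof. exact: (integrable_cst_mass1 _ (@probability_setT _ _ _ Pr)). Qed.

Lemma centered_second_moment l : \int[Pr]_w ((Y l w - e) ^+ 2)%:E <= v%:E.
Proof.
have -> : \int[Pr]_w ((Y l w - e) ^+ 2)%:E =
    \int[Pr]_w ((Y l w ^+ 2)%:E + ((- 2 * e)%:E * (Y l w)%:E + (e ^+ 2)%:E)).
  by apply: eq_integral => w _; rewrite -EFinM -!EFinD; congr EFin; ring.
rewrite integralD//; last first.
  by apply: integrableD => //; apply: integrableZl => //; exact: Y_int.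
rewrite integralD//; last by apply: integrableZl => //; exact: Y_int.
rewrite integralZl// Y_mean integral_cst_mass1; last exact: probability_setT.
rewrite -EFinM -EFinD; apply: le_trans (leeD (Y_sqr l) (lexx _)) _.
by rewrite -EFinD lee_fin; have := sqr_ge0 e; lra.
Qed.

Let prod_int l m : Pr.-integrable setT
  (fun w => ((Y l w - e) * (Y m w - e))%:E).
Proof.
have mZ i : measurable_fun setT (fun w => Y i w - e)%R by exact: measurable_funB.
have Z2 i : Pr.-integrable setT (fun w => ((Y i w - e) ^+ 2)%:E).
  exact: (sqr_integrable (@probability_setT _ _ _ Pr) (mZ i)
    (centered_second_moment i)).2.
apply: (@le_integrable _ _ _ Pr _ measurableT _
  (fun w => ((Y l w - e) ^+ 2)%:E + ((Y m w - e) ^+ 2)%:E)) => //.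
- by apply/measurable_EFinP; exact: measurable_funM.
- move=> w _; rewrite -EFinD /= lee_fin.
  rewrite [leRHS]ger0_norm ?addr_ge0 ?sqr_ge0//.
  (* The squares of the sum and of the difference of the two centered variables control the two
     signs of their product. *)
  by rewrite ler_norml; apply/andP; split;
    have := sqr_ge0 (Y l w - e + (Y m w - e)); have := sqr_ge0 (Y l w - Y m w); nra.
- exact: integrableD.
Qed.

(** Independence on rectangles identifies the joint law with the product of the marginals. Fubini
    then leaves an inner integral of [z - e] under the law of [Y m], which is zero. *)
Lemma uncorrelated l m : l != m ->
  \int[Pr]_w ((Y l w - e) * (Y m w - e))%:E = 0.
Proof.
move=> lm.
have mYY : measurable_fun setT (fun w => (Y l w, Y m w)).
  exact: measurable_fun_pair.
pose YY : {RV Pr >-> (R * R)%type} :=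
  HB.pack (fun w => (Y l w, Y m w)) (isMeasurableFun.Build _ _ _ _ _ mYY).
pose g (y : R * R) := ((y.1 - e) * (y.2 - e))%:E.
have mg : measurable_fun setT g.
  by apply/measurable_EFinP; apply: measurable_funM; apply: measurable_funB.
pose nl := distribution Pr (Y l); pose nm := distribution Pr (Y m).
have prodE : forall A, measurable A -> (nl \x nm) A = distribution Pr YY A.
  by apply: product_measure_unique => A B mA mB; exact: Y_indep.
(* Fubini needs integrability under the product law; it is carried over from [prod_int] through the
   joint law. *)
have gint : (nl \x nm).-integrable setT g.
  apply/integrableP; split => //.
  rewrite (eq_measure_integral (distribution Pr YY)); last first.
    by move=> A mA _; exact: prodE.
  rewrite ge0_integral_distribution//; last exact: measurableT_comp.
  by have /integrableP[] := prod_int l m.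
have -> : \int[Pr]_w ((Y l w - e) * (Y m w - e))%:E =
    \int[distribution Pr YY]_y g y.
  by rewrite integral_distribution//; exact: prod_int.
rewrite (eq_measure_integral (nl \x nm)); last first.
  by move=> A mA _; exact/esym/prodE.
rewrite -integral12_prod_meas1// integral0_eq// => y _.
have nm_int : nm.-integrable setT (EFin \o id).
  by apply: integrable_pushforward => //; [exact/measurable_EFinP|exact: Y_int].
have n1 r : nm.-integrable setT (fun=> r%:E).
  exact: (integrable_cst_mass1 _ (@probability_setT _ _ _ nm)).
transitivity (\int[nm]_z ((y - e)%:E * (z%:E + (- e)%:E))).
  by apply: eq_integral => z _; rewrite -EFinD -EFinM.
rewrite integralZl//; last exact: integrableD.
rewrite integralD//.
have -> : \int[nm]_z z%:E = e%:E.
  by rewrite -(Y_mean m) [LHS](integral_distribution (f := EFin))//; exact: Y_int.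
rewrite integral_cst_mass1; last exact: probability_setT.
by rewrite -EFinD subrr mule0.
Qed.

(** Expanding the square, the off-diagonal terms vanish and each of the [M] diagonal terms is at
    most [v]. *)
Lemma sum_second_moment :
  \int[Pr]_w ((\sum_(l < M) (Y l w - e)) ^+ 2)%:E <= (M%:R * v)%:E.
Proof.
have -> : \int[Pr]_w ((\sum_(l < M) (Y l w - e)) ^+ 2)%:E =
    \int[Pr]_w \sum_(l < M) \sum_(m < M) ((Y l w - e) * (Y m w - e))%:E.
  apply: eq_integral => w _; rewrite expr2 mulr_suml -sumEFin.
  by apply: eq_bigr => l _; rewrite mulr_sumr -sumEFin.
rewrite integral_sum//; last by move=> l; exact: integrable_sum.
apply: (@le_trans _ _ (\sum_(l < M) v%:E)); last first.
  by rewrite sumEFin sumr_const card_ord mulr_natl.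
apply: lee_sum => l _; rewrite integral_sum// (bigD1 l)//= big1 ?adde0.
  by under eq_integral do rewrite -expr2; exact: centered_second_moment.
by move=> m ml; rewrite uncorrelated// eq_sym.
Qed.

Lemma estimate_center w : (0 < M)%N ->
  (estimate (fun l => Y l : Omega -> R) w - e =
   (\sum_(l < M) (Y l w - e)) / M%:R)%R.
Proof.
move=> M0; rewrite /estimate sumrB sumr_const card_ord mulrBl.
rewrite -[(e *+ M)%R]mulr_natr.
by rewrite mulfK// pnatr_eq0 -lt0n.
Qed.

Lemma chebyshev_estimate : (0 < M)%N -> (0 < kappa)%R ->
  Pr [set w | (Num.sqrt (v / (kappa * M%:R)) <
               `|estimate (fun l => Y l : Omega -> R) w - e|)%R] <= kappa%:E.
Proof.
move=> M0 k0; have M0' : (0 < M%:R :> R)%R by rewrite ltr0n.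
(* [v] dominates the second moment of the first variable, which exists because [M > 0]. *)
have v0 : (0 <= v)%R.
  rewrite -lee_fin; apply: le_trans (Y_sqr (Ordinal M0)).
  by apply: integral_ge0 => w _; rewrite lee_fin sqr_ge0.
pose S w := (\sum_(l < M) (Y l w - e))%R.
have mS : measurable_fun setT S.
  by apply: measurable_sum => l; exact: measurable_funB.
(* Squaring and clearing [M] turns the event into an excess of [S w ^+ 2] over [c = M v / kappa];
   then [kappa * c = M v] is the bound on the second moment of [S]. *)
have -> : [set w | (Num.sqrt (v / (kappa * M%:R)) <
    `|estimate (fun l => Y l : Omega -> R) w - e|)%R] =
    [set w | (M%:R * v / kappa < S w ^+ 2)%R].
  apply/funext => w /=; apply/propext.
  rewrite -sqrtr_sqr ltNge ler_sqrt; last first.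
    by rewrite divr_ge0// ltW// mulr_gt0.
  rewrite -ltNge estimate_center// -/(S w).
  have -> : (v / (kappa * M%:R) < (S w / M%:R) ^+ 2)%R =
      (M%:R * v / kappa < S w ^+ 2)%R; last by [].
  rewrite expr_div_n ltr_pdivlMr ?exprn_gt0//; congr (_ < _)%R.
  by field; rewrite !gt_eqF.
apply: markov_strict.
- exact: measurable_funX.
- by move=> w; exact: sqr_ge0.
- by rewrite divr_ge0 ?mulr_ge0// ltW.
- exact: ltW.
- by rewrite mulrC divfK ?gt_eqF//; exact: sum_second_moment.
Qed.

End Concentration.

(** * The pair observable and its mean *)

(* The inverse is discontinuous at [0]; the identity [x^-1 = x * (x ^+ 2)^-1],
   also valid for [x = 0], reduces to a power of a nonnegative function. *)
Lemma measurable_funV (R : realType) d (T : measurableType d) (f : T -> R) :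
  measurable_fun setT f -> measurable_fun setT (fun t => (f t)^-1).
Proof.
move=> mf; rewrite (_ : (fun t => _) = fun t => f t * ((f t ^+ 2) `^ (- 1))).
  apply: measurable_funM => //.
  exact: (measurableT_comp (measurable_powR _) (measurable_funX 2 mf)).
apply/funext => t; rewrite powR_inv1 ?sqr_ge0//.
by have [->|f0] := eqVneq (f t) 0; rewrite ?invr0 ?mul0r// expr2 invfM mulVKf.
Qed.

(** * Componentwise measurability of complex-valued functions *)

Section ComplexMeasurable.
Context (R : realType) d (T : measurableType d).
Local Notation C := (R[i]).

(** Unfolds to the form in which measurability of [U] and [alpha] is assumed in the theorem. *)
Definition cmeasurable (f : T -> C) :=
  measurable_fun setT (fun t => complex.Re (f t)) /\
  measurable_fun setT (fun t => complex.Im (f t)).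

Lemma cmeasurable_cst (c : C) : cmeasurable (fun=> c).
Proof. by split; exact: measurable_cst. Qed.

Lemma cmeasurableM (f g : T -> C) :
  cmeasurable f -> cmeasurable g -> cmeasurable (fun t => f t * g t).
Proof.
move=> [f1 f2] [g1 g2]; split.
- under eq_fun do rewrite ReM.
  by apply: measurable_funB; exact: measurable_funM.
- under eq_fun do rewrite ImM.
  by apply: measurable_funD; exact: measurable_funM.
Qed.

Lemma cmeasurable_sum (I : Type) (r : seq I) (f : I -> T -> C) :
  (forall i, cmeasurable (f i)) -> cmeasurable (fun t => \sum_(i <- r) f i t).
Proof.
move=> mf; split.
- by under eq_fun do rewrite Re_sum; apply: measurable_sum => i; case: (mf i).
- by under eq_fun do rewrite Im_sum; apply: measurable_sum => i; case: (mf i).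
Qed.

Lemma cmeasurable_conjc (f : T -> C) :
  cmeasurable f -> cmeasurable (fun t => conjc (f t)).
Proof.
move=> [f1 f2]; split; first by under eq_fun do rewrite Re_conjc.
under eq_fun do rewrite Im_conjc.
exact: measurableT_comp.
Qed.

End ComplexMeasurable.

Lemma cmeasurable_comp (R : realType) d d' (T : measurableType d)
    (T' : measurableType d') (f : T -> R[i]) (h : T' -> T) :
  cmeasurable f -> measurable_fun setT h -> cmeasurable (fun t => f (h t)).
Proof.
move=> [f1 f2] mh.
by split; [exact: (measurableT_comp f1 mh)|exact: (measurableT_comp f2 mh)].
Qed.

Section Adjoint.
Variable R : realType.
Local Notation C := (R[i]).

Lemma adjM m n p (A : 'M[C]_(m, n)) (B : 'M[C]_(n, p)) :
  adj (A *m B) = adj B *m adj A.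
Proof. by rewrite /adj map_mxM trmx_mul. Qed.

Lemma adjZ m n (a : C) (A : 'M[C]_(m, n)) : adj (a *: A) = conjc a *: adj A.
Proof. by apply/matrixP => i j; rewrite !mxE rmorphM. Qed.

Lemma adjK m n (A : 'M[C]_(m, n)) : adj (adj A) = A.
Proof. by apply/matrixP => i j; rewrite !mxE conjcK. Qed.

Lemma Re_innerC N (u w : 'cV[C]_N) :
  complex.Re ((adj u *m w) 0 0) = complex.Re ((adj w *m u) 0 0).
Proof.
by rewrite !Re_inner; apply: eq_bigr => i _; rewrite mulrC [X in _ + X]mulrC.
Qed.

(** The unit vector [ket0] witnesses that [opnorm A] dominates some norm. *)
Lemma opnorm_ge0 n (A : 'M[C]_(2 ^ n)) : 0 <= opnorm A.
Proof.
by have := vnorm_mulmx_le A (ket0 R n); rewrite vnorm_ket0 mulr1;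
  exact/le_trans/vnorm_ge0.
Qed.

End Adjoint.

Section PairObservable.
Context (R : realType) d (Theta : measurableType d) (n : nat).
Local Notation C := (R[i]).
Variables (U : Theta -> 'M[C]_(2 ^ n)) (alpha : Theta -> C).
Hypothesis U_unitary : forall t, qunitary (U t).

(** Absorbing the phase into the state makes [Xpair] a plain sesquilinear form and [psi] a mean
    vector. *)
Definition phased (t : Theta) : 'cV[C]_(2 ^ n) := phase alpha t *: phi U t.

(** An inequality only: where [alpha t = 0], division by zero makes the phase 0 instead of a unit
    number. *)
Lemma cabs_phase_le1 t : cabs (phase alpha t) <= 1.
Proof.
rewrite /phase cabsM !cabs_normc Normc.normcV -!cabs_normc.
have -> : cabs (cabs (alpha t))%:C%C = cabs (alpha t).
  by rewrite {1}/cabs/= expr0n/= addr0 sqrtr_sqr ger0_norm// cabs_ge0.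
by have [->|a0] := eqVneq (cabs (alpha t)) 0; rewrite ?mul0r// divff.
Qed.

Lemma vnorm_phased_le1 t : vnorm (phased t) <= 1.
Proof. by rewrite vnormZ vnorm_unitary// vnorm_ket0 mulr1 cabs_phase_le1. Qed.

Lemma XpairE (O : 'M[C]_(2 ^ n)) t t' :
  Xpair U alpha O t t' = (adj (phased t') *m (O *m phased t)) 0 0.
Proof.
rewrite /Xpair /phased adjZ -scalemxAl -!scalemxAr scalerA mulmxA.
by rewrite [RHS]mxE [X in X * _ = _]mulrC.
Qed.

(** Cauchy-Schwarz for vectors of norm at most one. The constant [h] is kept abstract to serve both
    [opnorm H] and 1. *)
Lemma normr_Re_Xpair_le (O : 'M[C]_(2 ^ n)) (h : R) t t' : 0 <= h ->
  (forall v : 'cV[C]_(2 ^ n), vnorm (O *m v) <= h * vnorm v) ->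
  `|complex.Re (Xpair U alpha O t t')| <= h.
Proof.
move=> h0 Oh; rewrite XpairE (le_trans (normr_Re_inner_le _ _))//.
rewrite -[leRHS]mul1r ler_pM ?vnorm_ge0 ?vnorm_phased_le1//.
by rewrite (le_trans (Oh _))// ler_piMr// vnorm_phased_le1.
Qed.

Hypothesis U_meas : forall i j, cmeasurable (fun t => U t i j).
Hypothesis alpha_meas : cmeasurable alpha.
Hypothesis cabs_alpha_meas : measurable_fun setT (fun t => cabs (alpha t)).

Lemma cmeasurable_phase : cmeasurable (phase alpha).
Proof.
apply: cmeasurableM => //.
rewrite (_ : (fun t => _) = fun t => ((cabs (alpha t))^-1)%:C%C).
  by split; [exact: measurable_funV|exact: measurable_cst].
by apply/funext => t; rewrite fmorphV.
Qed.

Lemma cmeasurable_phased i : cmeasurable (fun t => phased t i 0).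
Proof.
under eq_fun do rewrite mxE mxE.
apply: cmeasurableM; first exact: cmeasurable_phase.
by apply: cmeasurable_sum => j; apply: cmeasurableM => //;
  exact: cmeasurable_cst.
Qed.

Lemma measurable_Re_Xpair (O : 'M[C]_(2 ^ n)) :
  measurable_fun setT (fun z => complex.Re (Xpair U alpha O z.1 z.2)).
Proof.
suff [] : cmeasurable (fun z : Theta * Theta => Xpair U alpha O z.1 z.2) by [].
under eq_fun do rewrite XpairE mxE.
apply: cmeasurable_sum => i; under eq_fun do rewrite mxE mxE.
apply: cmeasurableM.
  apply: cmeasurable_conjc; apply: (cmeasurable_comp (cmeasurable_phased i)).
  exact: measurable_snd.
under eq_fun do rewrite mxE.
apply: cmeasurable_sum => j; apply: cmeasurableM; first exact: cmeasurable_cst.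
by apply: (cmeasurable_comp (cmeasurable_phased j)); exact: measurable_fst.
Qed.

End PairObservable.

(** * Averaging inner products against a fixed vector *)

Section InnerMean.
Local Open Scope ereal_scope.
Context (R : realType) d (T : measurableType d) (mu : {measure set T -> \bar R}).
Context N (g : T -> 'cV[R[i]]_N) (m : 'cV[R[i]]_N).
Hypothesis Re_int : forall i,
  mu.-integrable setT (fun t => (complex.Re (g t i 0))%:E).
Hypothesis Im_int : forall i,
  mu.-integrable setT (fun t => (complex.Im (g t i 0))%:E).
Hypothesis Re_mean : forall i,
  \int[mu]_t (complex.Re (g t i 0))%:E = (complex.Re (m i 0))%:E.
Hypothesis Im_mean : forall i,
  \int[mu]_t (complex.Im (g t i 0))%:E = (complex.Im (m i 0))%:E.

(** The real part of the inner product is a finite real-linear combination of the real and imaginary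
    parts of the entries of [g t]. *)
Lemma integral_Re_inner (c : 'cV[R[i]]_N) :
  \int[mu]_t (complex.Re ((adj c *m g t) 0 0))%:E =
  (complex.Re ((adj c *m m) 0 0))%:E.
Proof.
have -> : \int[mu]_t (complex.Re ((adj c *m g t) 0 0))%:E =
    \int[mu]_t \sum_i ((complex.Re (c i 0))%:E * (complex.Re (g t i 0))%:E +
                       (complex.Im (c i 0))%:E * (complex.Im (g t i 0))%:E).
  apply: eq_integral => t _; rewrite Re_inner -sumEFin.
  by apply: eq_bigr => i _; rewrite EFinD !EFinM.
have Rei i : mu.-integrable setT
    (fun t => (complex.Re (c i 0))%:E * (complex.Re (g t i 0))%:E).
  by apply: integrableZl.
have Imi i : mu.-integrable setT
    (fun t => (complex.Im (c i 0))%:E * (complex.Im (g t i 0))%:E).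
  by apply: integrableZl.
rewrite integral_sum//; last by move=> i; exact: integrableD.
rewrite Re_inner -sumEFin; apply: eq_bigr => i _.
by rewrite integralD// !integralZl// Re_mean Im_mean EFinD !EFinM.
Qed.

End InnerMean.

(** * Mean, law and concentration of the sampled estimator *)

Section Sampling.
Local Open Scope ereal_scope.
Context (R : realType) d (Theta : measurableType d) (n : nat).
Variable mu : {measure set Theta -> \bar R}.
Variables (U : Theta -> 'M[R[i]]_(2 ^ n)) (alpha : Theta -> R[i]).
Hypothesis U_unitary : forall t, qunitary (U t).
Hypothesis U_meas : forall i j, cmeasurable (fun t => U t i j).
Hypothesis alpha_meas : cmeasurable alpha.
Hypothesis alpha_int : mu.-integrable setT (fun t => (cabs (alpha t))%:E).
Hypothesis C_pos : (0 < normconst mu alpha)%R.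

Lemma measurable_cabs_alpha : measurable_fun setT (fun t => cabs (alpha t)).
Proof. by have /integrableP[/measurable_EFinP] := alpha_int. Qed.

Lemma Pdens_ge0 t : (0 <= Pdens mu alpha t)%R.
Proof. by rewrite divr_ge0 ?cabs_ge0// ltW. Qed.

Lemma measurable_Pdens : measurable_fun setT (Pdens mu alpha).
Proof.
by apply: measurable_funM; [exact: measurable_cabs_alpha|exact: measurable_cst].
Qed.

Lemma integral_Pdens : \int[mu]_t (Pdens mu alpha t)%:E = 1.
Proof.
rewrite /Pdens; under eq_integral do rewrite EFinM.
rewrite integralZr//.
have -> : \int[mu]_t (cabs (alpha t))%:E = (normconst mu alpha)%:E.
  by rewrite fineK//; exact: integrable_fin_num.
by rewrite -EFinM divff// gt_eqF.
Qed.

Local Notation Q := (density_prob Pdens_ge0 measurable_Pdens integral_Pdens).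

Let bounded_int (f : Theta -> R) : measurable_fun setT f ->
  (forall t, `|f t| <= 1)%R -> Q.-integrable setT (fun t => (f t)%:E).
Proof.
move=> mf f1; apply: (@le_integrable _ _ _ _ _ measurableT _ (fun=> 1%:E)) => //.
- exact/measurable_EFinP.
- by move=> t _; rewrite /= lee_fin normr1.
- exact: (integrable_cst_mass1 _ (@probability_setT _ _ _ Q)).
Qed.

Let m_phased i : cmeasurable (fun t => phased U alpha t i 0%R).
Proof. exact: (cmeasurable_phased U_meas alpha_meas measurable_cabs_alpha). Qed.

Let cabs_phased t i : (cabs (phased U alpha t i 0%R) <= 1)%R.
Proof. exact: le_trans (cabs_le_vnorm _ _) (vnorm_phased_le1 _ U_unitary _). Qed.

Let Re_phased_int i :
  Q.-integrable setT (fun t => (complex.Re (phased U alpha t i 0%R))%:E).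
Proof.
apply: bounded_int => [|t]; first by case: (m_phased i).
exact: le_trans (Re_le_cabs _) (cabs_phased t i).
Qed.

Let Im_phased_int i :
  Q.-integrable setT (fun t => (complex.Im (phased U alpha t i 0%R))%:E).
Proof.
apply: bounded_int => [|t]; first by case: (m_phased i).
exact: le_trans (Im_le_cabs _) (cabs_phased t i).
Qed.

(** The weight [Pdens] in the definition of [psi] moves into the measure, so [psi] is the mean of
    [phased] under [Q]. *)
Lemma Re_phased_mean i : \int[Q]_t (complex.Re (phased U alpha t i 0%R))%:E =
  (complex.Re (psi mu U alpha i 0%R))%:E.
Proof.
rewrite -[LHS]fineK; last exact: integrable_fin_num (Re_phased_int i).
congr EFin; rewrite -/(Rintegral _ _ _) Rintegral_density; last first.
  by case: (m_phased i).
rewrite mxE /=; apply: eq_Rintegral => t _.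
by rewrite -mulrA ReM /= mul0r subr0 mxE.
Qed.

Lemma Im_phased_mean i : \int[Q]_t (complex.Im (phased U alpha t i 0%R))%:E =
  (complex.Im (psi mu U alpha i 0%R))%:E.
Proof.
rewrite -[LHS]fineK; last exact: integrable_fin_num (Im_phased_int i).
congr EFin; rewrite -/(Rintegral _ _ _) Rintegral_density; last first.
  by case: (m_phased i).
rewrite mxE /=; apply: eq_Rintegral => t _.
by rewrite -mulrA ImM /= mul0r addr0 mxE.
Qed.

Variables (O : 'M[R[i]]_(2 ^ n)) (h : R).
Hypothesis h_ge0 : (0 <= h)%R.
Hypothesis O_le : forall v : 'cV[R[i]]_(2 ^ n), (vnorm (O *m v) <= h * vnorm v)%R.

(** Fubini, justified by the bound [h], averages one state at a time: first over [t'], then over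
    [t], each average replacing [phased] by [psi]. *)
Lemma Re_Xpair_mean :
  \int[Q \x Q]_z (complex.Re (Xpair U alpha O z.1 z.2))%:E =
  (complex.Re (expect mu U alpha O))%:E.
Proof.
have mX : measurable_fun setT
    (fun z => (complex.Re (Xpair U alpha O z.1 z.2))%:E).
  apply/measurable_EFinP.
  exact: (measurable_Re_Xpair U_meas alpha_meas measurable_cabs_alpha).
rewrite -integral12_prod_meas1/=; last first.
  apply: (@le_integrable _ _ _ _ _ measurableT _ (fun=> h%:E)) => //.
  - move=> z _; rewrite /= lee_fin [leRHS]ger0_norm//.
    exact: normr_Re_Xpair_le.
  - exact: (integrable_cst_mass1 _ (@probability_setT _ _ _ (Q \x Q))).
(* Moving [O] to the left as its adjoint leaves [phased] paired with a fixed vector, so that the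
   averaging lemma applies again. *)
transitivity (\int[Q]_t (complex.Re
    ((adj (adj O *m psi mu U alpha) *m phased U alpha t) 0 0))%:E).
  apply: eq_integral => t _.
  rewrite /fubini_F /=; under eq_integral do rewrite XpairE Re_innerC.
  rewrite (integral_Re_inner Re_phased_int Im_phased_int Re_phased_mean
    Im_phased_mean).
  by rewrite Re_innerC adjM adjK mulmxA.
rewrite (integral_Re_inner Re_phased_int Im_phased_int Re_phased_mean
  Im_phased_mean).
by rewrite adjM adjK.
Qed.

Context d' (Omega : measurableType d') (Pr : probability Omega R).
Variables (sigma : R) (M : nat).
Variables (a b : 'I_M -> Omega -> Theta) (Y : 'I_M -> Omega -> R).
Hypothesis model : estimator_model Pr mu (Pdens mu alpha)
  (fun t t' => complex.Re (Xpair U alpha O t t')) sigma a b Y.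

(** Mutual independence of the triples is applied to the index pair [l], [m], with events that
    constrain only the measured value. *)
Lemma model_indep l m : l != m -> forall A B : set R,
  measurable A -> measurable B ->
  Pr (Y l @^-1` A `&` Y m @^-1` B) = Pr (Y l @^-1` A) * Pr (Y m @^-1` B).
Proof.
move=> lm A B mA mB; have [_ indep _] := model.
pose E i : set (Theta * Theta * R) := snd @^-1` (if i == l then A else B).
have mE i : measurable (E i).
  rewrite -[E i]setTI; apply: measurable_snd => //.
  by case: ifP.
have := indep [set l; m]%SET E mE.
rewrite big_setU1 ?inE//= big_set1 /E eqxx eq_sym (negbTE lm) => <-.
congr (Pr _); apply/seteqP; split => [w [Al Bm] i /=|w /= H].
  by rewrite !inE => /orP[]/eqP ->; rewrite ?eqxx// eq_sym (negbTE lm).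
split; first by have := H l; rewrite /= !inE !eqxx; exact.
by have := H m; rewrite /= !inE eqxx orbT [m == l]eq_sym (negbTE lm); exact.
Qed.

(** Tonelli and the density formula turn the iterated [mu]-integral of the model into an integral
    over [Q \x Q]. *)
Lemma model_law : exists k : R.-pker (Theta * Theta)%type ~> R,
  (forall z, [/\ (k z).-integrable setT EFin,
    \int[k z]_y (y%:E) = (complex.Re (Xpair U alpha O z.1 z.2))%:E &
    \int[k z]_y (((y - complex.Re (Xpair U alpha O z.1 z.2)) ^+ 2)%:E)
      <= (sigma ^+ 2)%:E]) /\
  (forall l F, measurable F ->
    Pr (Y l @^-1` F) = \int[Q \x Q]_z k z F).
Proof.
have [_ _ [k [kX kPr]]] := model; exists k; split.
  by move=> -[t t']; have := kX t t'.
move=> l F mF.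
have mk : measurable_fun [set: Theta * Theta] (k ^~ F).
  exact: measurable_kernel.
have k0 z : 0 <= k z F by [].
have mP : measurable_fun setT (fun t => (Pdens mu alpha t)%:E).
  exact/measurable_EFinP/measurable_Pdens.
have P0 t : 0 <= (Pdens mu alpha t)%:E by rewrite lee_fin Pdens_ge0.
have mkt t : measurable_fun [set: Theta] (fun t' => k (t, t') F).
  exact: (measurableT_comp mk (measurable_pair1 t)).
rewrite fubini_tonelli1// ge0_integral_density//; last 2 first.
- by move=> t; exact: integral_ge0.
- exact: measurable_fun_fubini_tonelli_F.
(* Full sets for both parameters leave the marginal law of the measured value. *)
have := kPr l setT setT F measurableT measurableT mF.
rewrite (_ : [set w | _] = Y l @^-1` F); last first.
  by apply/seteqP; split => w /=; [case=> _ []|].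
move=> ->; apply: eq_integral => t _.
rewrite /fubini_F ge0_integral_density//.
rewrite -ge0_integralZl//.
- by apply: eq_integral => t' _; rewrite EFinM muleA.
- by apply: emeasurable_funM.
- by move=> t' _; rewrite mule_ge0.
Qed.

Hypothesis M_pos : (0 < M)%N.
Variable kappa : R.
Hypothesis kappa_pos : (0 < kappa)%R.

(** The law of each [Y l] is a mixture over [Q \x Q], which supplies the mean and second moment
    required by Chebyshev's inequality. *)
Lemma estimate_concentration :
  Pr [set w | (Num.sqrt ((h ^+ 2 + sigma ^+ 2) / (kappa * M%:R)) <
    `|estimate Y w - complex.Re (expect mu U alpha O)|)%R] <= kappa%:E.
Proof.
have [mabY _ _] := model.
have mY l : measurable_fun setT (Y l) by case: (mabY l).
pose YR l : {RV Pr >-> R} := HB.pack (Y l) (isMeasurableFun.Build _ _ _ _ _ (mY l)).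
have [k [kX kPr]] := model_law.
have k_int z : (k z).-integrable setT EFin by have [] := kX z.
have k_mean z := (let: And3 _ e _ := kX z in e).
have k_var z := (let: And3 _ _ e := kX z in e).
have X_le z : (`|complex.Re (Xpair U alpha O z.1 z.2)| <= h)%R.
  exact: normr_Re_Xpair_le.
have Y_sqr l : \int[Pr]_w (YR l w ^+ 2)%:E <= (h ^+ 2 + sigma ^+ 2)%:E.
  have := mixture_second_moment k_int k_mean k_var X_le
    (nu := distribution Pr (YR l)) (kPr l).
  rewrite ge0_integral_distribution//; last by move=> y; rewrite lee_fin sqr_ge0.
  by apply/measurable_EFinP; exact: measurable_funX.
have Y_mean l : \int[Pr]_w (YR l w)%:E = (complex.Re (expect mu U alpha O))%:E.
  rewrite -Re_Xpair_mean -(mixture_mean k_int k_mean k_var X_le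
    (nu := distribution Pr (YR l)) (kPr l)).
  rewrite [RHS](integral_distribution (f := EFin))//.
  exact: (sqr_integrable (@probability_setT _ _ _ Pr) (mY l) (Y_sqr l)).1.
have YR_indep : forall l m, l != m -> forall A B : set R,
    measurable A -> measurable B ->
    Pr (YR l @^-1` A `&` YR m @^-1` B) = Pr (YR l @^-1` A) * Pr (YR m @^-1` B).
  exact: model_indep.
exact: (chebyshev_estimate YR_indep Y_mean Y_sqr M_pos kappa_pos).
Qed.

End Sampling.

(** * Bounds on the ratio of the estimators *)

(** Cauchy-Schwarz gives the bound [opnorm O] times the squared norm of [psi], and that squared norm
    is the expectation of the identity. *)
Lemma normr_Re_expect_le (R : realType) d (Theta : measurableType d)
    (mu : {measure set Theta -> \bar R}) (n : nat)
    (U : Theta -> 'M[R[i]]_(2 ^ n)) (alpha : Theta -> R[i])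
    (O : 'M[R[i]]_(2 ^ n)) :
  `|complex.Re (expect mu U alpha O)| <=
  opnorm O * complex.Re (expect mu U alpha 1%:M).
Proof.
rewrite /expect mulmx1 -mulmxA -sqr_vnorm_inner.
rewrite (le_trans (normr_Re_inner_le _ _))// expr2 mulrA mulrC.
by rewrite ler_wpM2r ?vnorm_ge0// vnorm_mulmx_le.
Qed.

Lemma shifted_ratio_bounds (R : realFieldType) (x N a b etaX etaN h : R) :
  0 < N -> 0 <= h -> `|x| <= h * N -> `|a - x| <= etaX -> `|b - N| <= etaN ->
  Num.min (x / N) 0 <= (a + etaX) / (b + etaN) <=
  x / N + 2 * ((etaX + h * etaN) / N).
Proof.
move=> N0 h0; rewrite !ler_norml => /andP[xl xu] /andP[al au] /andP[bl bu].
have etaN0 : 0 <= etaN by lra.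
have etaX0 : 0 <= etaX by lra.
set p := a + etaX; set q := b + etaN.
have px : x <= p by rewrite /p; lra.
have pu : p <= x + 2 * etaX by rewrite /p; lra.
have qN : N <= q by rewrite /q; lra.
have qu : q <= N + 2 * etaN by rewrite /q; lra.
have q0 : 0 < q by lra.
apply/andP; split.
  rewrite ge_min; have [x0|x0] := leP 0 x.
    by apply/orP; right; rewrite divr_ge0; lra.
  (* For [x < 0], enlarging the denominator raises the ratio: [x / N <= x / q <= p / q]. *)
  apply/orP; left; rewrite ler_pdivlMr// mulrAC ler_pdivrMr//.
  by nra.
have -> : x / N + 2 * ((etaX + h * etaN) / N) =
    (x + 2 * etaX + 2 * h * etaN) / N by field; rewrite gt_eqF.
rewrite ler_pdivrMr// mulrAC ler_pdivlMr//.
have hN : 0 <= h * etaN by rewrite mulr_ge0.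
set y := x + 2 * etaX in pu *.
have y_ge : - (h * N) <= y by rewrite /y; lra.
(* [p * N <= y * N], and [y * (q - N) >= - h * N * 2 * etaN] since
   [y >= - h * N] and [0 <= q - N <= 2 * etaN] *)
have pN : p * N <= y * N by rewrite ler_pM2r.
have yq : - (h * N) * (q - N) <= y * (q - N) by rewrite ler_wpM2r; lra.
have hq : h * N * (q - N) <= h * N * (2 * etaN).
  by apply: ler_wpM2l; [rewrite mulr_ge0// ltW|lra].
have hNq : 2 * (h * etaN) * N <= 2 * (h * etaN) * q by rewrite ler_wpM2l; lra.
(* The chain is [p N <= y N = y q - y (q - N) <= y q + h N (q - N) <= y q + 2 h etaN N <= (y + 2 h
   etaN) q]. *)
lra.
Qed.

Theorem theorem2 (R : realType) (n : nat)
  (d : measure_display) (Theta : measurableType d)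
  (mu : {measure set Theta -> \bar R}) (mu_sigma : sigma_finite setT mu)
  (U : Theta -> 'M[R[i]]_(2 ^ n))
  (U_unitary : forall t, qunitary (U t))
  (U_meas : forall i j, measurable_fun setT (fun t => complex.Re (U t i j)) /\
                        measurable_fun setT (fun t => complex.Im (U t i j)))
  (alpha : Theta -> R[i])
  (alpha_meas : measurable_fun setT (fun t => complex.Re (alpha t)) /\
                measurable_fun setT (fun t => complex.Im (alpha t)))
  (alpha_int : mu.-integrable setT (fun t => (cabs (alpha t))%:E))
  (C_pos : 0 < normconst mu alpha)
  (H : 'M[R[i]]_(2 ^ n)) (H_herm : qhermitian H)
  (one_pos : 0 < complex.Re (expect mu U alpha 1%:M))
  (sigmaH sigma1 : R) (M : nat) (M_pos : (0 < M)%N)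
  (kappa : R) (kappa_pos : 0 < kappa)
  (dO : measure_display) (Omega : measurableType dO) (Pr : probability Omega R)
  (aH bH : 'I_M -> Omega -> Theta) (XhH : 'I_M -> Omega -> R)
  (a1 b1 : 'I_M -> Omega -> Theta) (Xh1 : 'I_M -> Omega -> R)
  (modelH : estimator_model Pr mu (Pdens mu alpha)
              (fun t t' => complex.Re (Xpair U alpha H t t')) sigmaH aH bH XhH)
  (model1 : estimator_model Pr mu (Pdens mu alpha)
              (fun t t' => complex.Re (Xpair U alpha 1%:M t t')) sigma1 a1 b1 Xh1) :
  let expH := complex.Re (expect mu U alpha H) in
  let exp1 := complex.Re (expect mu U alpha 1%:M) in
  let tildeH := expH / exp1 in
  let etaH := Num.sqrt ((opnorm H ^+ 2 + sigmaH ^+ 2) / (kappa * M%:R)) in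
  let eta1 := Num.sqrt ((1 + sigma1 ^+ 2) / (kappa * M%:R)) in
  let L'' := fun w => (estimate XhH w + etaH) / (estimate Xh1 w + eta1) in
  let good := [set w : Omega | Num.min tildeH 0 <= L'' w <=
                               tildeH + 2 * ((etaH + opnorm H * eta1) / exp1)] in
  ((1 - 2 * kappa)%:E <= Pr good)%E.

Proof.
pose expH := complex.Re (expect mu U alpha H).
pose exp1 := complex.Re (expect mu U alpha 1%:M).
pose tildeH := expH / exp1.
pose etaH := Num.sqrt ((opnorm H ^+ 2 + sigmaH ^+ 2) / (kappa * M%:R)).
pose eta1 := Num.sqrt ((1 + sigma1 ^+ 2) / (kappa * M%:R)).
pose L'' w := (estimate XhH w + etaH) / (estimate Xh1 w + eta1).
pose good := [set w : Omega | Num.min tildeH 0 <= L'' w <=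
                              tildeH + 2 * ((etaH + opnorm H * eta1) / exp1)].
suff : ((1 - 2 * kappa)%:E <= Pr good)%E by [].
have opH := opnorm_ge0 H.
have mean_le := normr_Re_expect_le mu U alpha H.
have concH := estimate_concentration U_unitary U_meas alpha_meas alpha_int C_pos
  opH (vnorm_mulmx_le H) modelH M_pos kappa_pos.
(* The identity satisfies the operator bound with [h = 1], which produces the 1 in [eta1]. *)
have one_le (v : 'cV[R[i]]_(2 ^ n)) : vnorm (1%:M *m v) <= 1 * vnorm v.
  by rewrite mul1mx mul1r.
have conc1 := estimate_concentration U_unitary U_meas alpha_meas alpha_int C_pos
  ler01 one_le model1 M_pos kappa_pos.
rewrite expr1n -/exp1 -/eta1 in conc1; rewrite -/expH -/etaH in concH.
set badH := [set w | _] in concH; set bad1 := [set w | _] in conc1.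
have mest (Y : 'I_M -> Omega -> R) : (forall l, measurable_fun setT (Y l)) ->
    measurable_fun setT (estimate Y).
  move=> mY; apply: measurable_funM => //; exact: measurable_sum.
have mH : measurable_fun setT (estimate XhH).
  by apply: mest => l; case: modelH => /(_ l)[].
have m1 : measurable_fun setT (estimate Xh1).
  by apply: mest => l; case: model1 => /(_ l)[].
have mbad (f : Omega -> R) (c e : R) : measurable_fun setT f ->
    measurable [set w | c < `|f w - e|].
  move=> mf; rewrite (_ : [set w | _] = (fun w => `|f w - e|) @^-1` `]c, +oo[).
    rewrite -[X in measurable X]setTI.
    have mabs : measurable_fun setT (fun w => `|f w - e|).
      by apply: measurableT_comp => //; exact: measurable_funB.
    exact: mabs.
  by apply/seteqP; split => w /=; rewrite in_itv/= andbT.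
have mbadH : measurable badH by exact: mbad.
have mbad1 : measurable bad1 by exact: mbad.
(* [L''] is measurable on the whole space, also where its denominator vanishes and the inverse takes
   its default value. *)
have mgood : measurable good.
  have mL : measurable_fun setT L''.
    apply: measurable_funM; first exact: measurable_funD.
    by apply: measurable_funV; exact: measurable_funD.
  rewrite (_ : good = L'' @^-1` `[Num.min tildeH 0,
      tildeH + 2 * ((etaH + opnorm H * eta1) / exp1)]).
    by rewrite -[X in measurable X]setTI; exact: mL.
  by apply/seteqP; split => w /=; rewrite in_itv.
(* Outside both bad events the deterministic ratio bounds hold pointwise. *)
have sub : ~` (badH `|` bad1) `<=` good.
  move=> w /= /not_orP[/negP]; rewrite -leNgt => wH /negP; rewrite -leNgt => w1.
  exact: shifted_ratio_bounds.
have mbad_union : measurable (badH `|` bad1) by exact: measurableU.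
(* Union bound: the complement of the two bad events has probability at least [1 - 2 * kappa]. *)
apply: (@le_trans _ _ (Pr (~` (badH `|` bad1)))); last first.
  by apply: le_measure => //; rewrite inE//; exact: measurableC.
rewrite probability_setC// EFinB leeB//.
apply: le_trans (measureU2 _ mbadH mbad1) _.
by rewrite mulr_natl mulr2n EFinD leeD.
Qed.
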